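(* Let $a,b\in\mathbb{N}$ with $(a,b)=1$, $a\geq b\geq 2$ and $b\neq 3$. Then $S(1,a,b)\in\left\{0,\ \tfrac{b}{2},\ -\tfrac{b}{2}\right\}$.
   Context: $\mathbb{N}$ denotes the positive integers and $(a,b)$ the greatest common divisor. For $n,a,b\in\mathbb{N}$ with $b\geq 2$, define $$S(n,a,b):=\sum_{m=1}^{b-1}\cot\left(\frac{\pi m}{b}\right)\sin^{3}\left(2\pi mn\frac{a}{b}\right).$$ *)

(* Defs.v *)
From mathcomp Require Import all_boot all_order all_algebra.
From mathcomp Require Import reals trigo.

Set Implicit Arguments.
Unset Strict Implicit.
Unset Printing Implicit Defensive.

Import Order.TTheory GRing.Theory Num.Theory.

Local Open Scope ring_scope.

Definition cot (R : realType) (x : R) : R := cos x / sin x.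

(* S(n,a,b), meant for n, a >= 1 and b >= 2.  Every angle pi * m / b in the sum
   lies strictly between 0 and pi, so cot is never evaluated at a zero of sin. *)
Definition cot_sin3_sum (R : realType) (n a b : nat) : R :=
  \sum_(1 <= m < b)
    cot (pi * m%:R / b%:R) * sin (2 * pi * m%:R * n%:R * (a%:R / b%:R)) ^+ 3.

Arguments cot_sin3_sum : clear implicits.

(* Main.v *)
Require Import Defs.
From mathcomp Require Import all_boot all_order all_algebra.
From mathcomp Require Import reals trigo.
From mathcomp Require Import ring lra.

Import Order.TTheory GRing.Theory Num.Theory.

Local Open Scope ring_scope.

(** Since 4 sin^3 x = 3 sin x - sin (3 x), the sum is (3 T(a) - T(3 a)) / 4 with
    T(k) = \sum_(1 <= m < b) cot (pi m / b) sin (2 pi k m / b). This T is b-periodic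
    and equals b - 2 k for 0 < k < b (T is a discrete sawtooth): the difference
    T(k+1) - T(k) is the sum of cos (2 pi (k+1) m / b) + cos (2 pi k m / b), because
    sin (2 (k+1) x) - sin (2 k x) = 2 cos ((2 k + 1) x) sin x cancels the
    denominator of the cotangent. If r = a mod b and 3 r = j b + s with 0 < s < b
    and j in {0, 1, 2}, the sum is therefore b (1 - j) / 2; s = 0 would force b to
    divide 3. *)

Definition cot_sin_sum (R : realType) (b k : nat) : R :=
  \sum_(1 <= m < b) cot (pi * m%:R / b%:R) * sin (2 * k%:R * (pi * m%:R / b%:R)).

Lemma sinD2piMn (R : realType) (x : R) (n : nat) : sin (x + 2 * pi * n%:R) = sin x.
Proof.
rewrite -[RHS](periodicn (@sinD2pi R) n); congr sin; ring.
Qed.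

Lemma sin_piM_gt0 (R : realType) (k b : nat) :
  (0 < k < b)%N -> 0 < sin (pi * k%:R / b%:R : R).
Proof.
move=> /andP[k0 kb].
have b0 : 0 < b%:R :> R by rewrite ltr0n (leq_trans _ kb).
apply: sin_gt0_pi; apply/andP; split.
  by rewrite divr_gt0 // mulr_gt0 ?pi_gt0 // ltr0n.
by rewrite ltr_pdivrMr // ltr_pM2l ?pi_gt0 // ltr_nat.
Qed.

Lemma sin_cube (R : realType) (x : R) : sin x ^+ 3 = (3 * sin x - sin (3 * x)) / 4.
Proof.
have -> : 3 * x = x *+ 2 + x by ring.
rewrite sinD sin_mulr2n cos_mulr2n.
have := cos2sin2 x => c2.
have -> : (cos x * sin x) *+ 2 * cos x = cos x ^+ 2 * sin x * 2 by ring.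
by rewrite c2; field.
Qed.

(** Multiplied by [2 * sin t] with [t] = pi k / b, the sum telescopes to [f b - f 1] = -2 sin t, and
    sin t is nonzero because 0 < k < b. *)
Lemma sum_cos_nontrivial (R : realType) (b k : nat) : (0 < k < b)%N ->
  \sum_(1 <= m < b) cos (2 * k%:R * (pi * m%:R / b%:R)) = -1 :> R.
Proof.
move=> kb; have s0 := sin_piM_gt0 R _ _ kb; move/andP: kb => [k0 kb].
have b1 : (1 <= b)%N by rewrite (leq_trans _ kb).
have b0 : b%:R != 0 :> R by rewrite pnatr_eq0 -lt0n.
pose t : R := pi * k%:R / b%:R.
pose f (m : nat) : R := sin ((2 * m%:R - 1) * t).
have fE m : f m.+1 - f m = 2 * sin t * cos (2 * k%:R * (pi * m%:R / b%:R)).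
  have -> : 2 * k%:R * (pi * m%:R / b%:R) = 2 * m%:R * t by rewrite /t; field.
  rewrite /f.
  have -> : (2 * m.+1%:R - 1) * t = 2 * m%:R * t + t by rewrite -natr1; ring.
  have -> : (2 * m%:R - 1) * t = 2 * m%:R * t - t by ring.
  by rewrite sinD sinB; ring.
(* Here (2 b - 1) t = 2 pi k - t. *)
have fb : f b = - sin t.
  rewrite /f -sinN -[RHS](sinD2piMn _ _ k); congr sin.
  by rewrite /t; field.
have f1 : f 1%N = sin t by rewrite /f; congr sin; ring.
have := telescope_sumr f b1; under eq_bigr do rewrite fE.
rewrite -mulr_sumr fb f1 => eqS.
have s2 : 2 * sin t != 0 by rewrite mulf_neq0 ?gt_eqF.
by apply: (mulfI s2); rewrite eqS; ring.
Qed.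

Lemma cot_sin_sum_step (R : realType) (b k : nat) :
  cot_sin_sum R b k.+1 = cot_sin_sum R b k
    + \sum_(1 <= m < b) cos (2 * k.+1%:R * (pi * m%:R / b%:R))
    + \sum_(1 <= m < b) cos (2 * k%:R * (pi * m%:R / b%:R)).
Proof.
rewrite /cot_sin_sum -!big_split; apply: eq_big_nat => m mb /=.
have := sin_piM_gt0 R _ _ mb; set x := pi * _ / _ => s0.
have sx0 : sin x != 0 by rewrite gt_eqF.
(* [y] is the midpoint of the two angles 2 k x and 2 (k + 1) x. *)
pose y := (2 * k%:R + 1) * x.
have -> : 2 * k.+1%:R * x = y + x by rewrite /y -natr1; ring.
have -> : 2 * k%:R * x = y - x by rewrite /y; ring.
by rewrite /cot sinD sinB cosD cosB; field.
Qed.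

Lemma cot_sin_sum_sawtooth (R : realType) (b k : nat) : (0 < k < b)%N ->
  cot_sin_sum R b k = b%:R - 2 * k%:R.
Proof.
case: k => // k; elim: k => [|k IHk] kb; rewrite cot_sin_sum_step.
  (* The first step is special: at index 0 the sines vanish and the cosine sum is b - 1, so the
     value at 1 is b - 2. Every later step adds -1 twice. *)
  rewrite sum_cos_nontrivial // /cot_sin_sum big1; last first.
    by move=> m _; rewrite mulr0 mul0r sin0 mulr0.
  under eq_bigr do rewrite mulr0 mul0r cos0.
  rewrite sumr_const_nat natrB; first by ring.
  by case: b kb.
have kb' : (0 < k.+1 < b)%N by rewrite /= ltnW.
by rewrite !sum_cos_nontrivial // IHk // -[k.+2%:R]natr1; ring.
Qed.

Lemma cot_sin_sum_periodic (R : realType) (b q k : nat) :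
  cot_sin_sum R b (q * b + k) = cot_sin_sum R b k.
Proof.
apply: eq_big_nat => m /andP[m1 mb]; congr (_ * _).
have b0 : b%:R != 0 :> R by rewrite pnatr_eq0 -lt0n (leq_trans _ mb).
rewrite -[RHS](sinD2piMn _ _ (q * m)); congr sin.
by rewrite natrD !natrM; field.
Qed.

Lemma cot_sin3_sumE (R : realType) (a b : nat) :
  cot_sin3_sum R 1 a b = (3 * cot_sin_sum R b a - cot_sin_sum R b (3 * a)) / 4.
Proof.
rewrite /cot_sin3_sum /cot_sin_sum mulr_sumr -sumrB mulr_suml.
apply: eq_bigr => m _; rewrite sin_cube.
have -> : 2 * pi * m%:R * 1 * (a%:R / b%:R) = 2 * a%:R * (pi * m%:R / b%:R) :> R.
  by ring.
have -> : 3 * (2 * a%:R * (pi * m%:R / b%:R))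
  = 2 * (3 * a)%:R * (pi * m%:R / b%:R) :> R by rewrite natrM; ring.
by ring.
Qed.

Theorem proposition1p2 (R : realType) (a b : nat)
    (coprime_ab : coprime a b) (le_ba : (b <= a)%N) (le_2b : (2 <= b)%N)
    (b_neq3 : b <> 3%N) :
  cot_sin3_sum R 1 a b \in [:: 0; b%:R / 2; - (b%:R / 2)].
Proof.
have b0 : (0 < b)%N by exact: ltnW.
have nz_mod n : ~~ (b %| n)%N -> (0 < n %% b < b)%N.
  by rewrite lt0n ltn_mod b0 andbT.
have ndiv_a : ~~ (b %| a)%N.
  apply/negP => /gcdn_idPr; move/eqP: coprime_ab => -> b1.
  by rewrite -b1 in le_2b.
have ndiv_3a : ~~ (b %| 3 * a)%N.
  (* By coprimality b would divide 3, hence be 1 or 3. *)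
  rewrite Gauss_dvdl ?(coprime_sym b) //.
  apply/negP => /(primeP (isT : prime 3)).2 /orP[] /eqP // b1.
  by rewrite b1 in le_2b.
have r_bd := nz_mod _ ndiv_a; set r := (a %% b)%N in r_bd.
have ndiv_3r : ~~ (b %| 3 * r)%N by rewrite /dvdn modnMmr.
have s_bd := nz_mod _ ndiv_3r; set s := (3 * r %% b)%N in s_bd.
have Er := divn_eq (3 * r) b; set j := (3 * r %/ b)%N in Er.
have j3 : (j < 3)%N.
  by rewrite /j ltn_divLR // ltn_pmul2l //; case/andP: r_bd.
have Ta : cot_sin_sum R b a = b%:R - 2 * r%:R.
  by rewrite (divn_eq a b) cot_sin_sum_periodic cot_sin_sum_sawtooth.
have T3a : cot_sin_sum R b (3 * a) = b%:R - 2 * s%:R.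
  (* Periodicity serves twice: to pass from 3 a to 3 r, then from 3 r to [s]. *)
  rewrite (divn_eq a b) mulnDr mulnA cot_sin_sum_periodic -/r Er.
  by rewrite cot_sin_sum_periodic cot_sin_sum_sawtooth.
have ErR : 3 * r%:R = j%:R * b%:R + s%:R :> R.
  by rewrite -!natrM Er natrD natrM.
(* 3 (b - 2 r) - (b - 2 s) = 2 b - 2 (3 r - s) = 2 b (1 - j). *)
have -> : cot_sin3_sum R 1 a b = (1 - j%:R) * (b%:R / 2).
  by rewrite cot_sin3_sumE Ta T3a; lra.
clearbody j; rewrite !inE; clear -j3.
case: j j3 => [|[|[|//]]] _.
- by rewrite subr0 mul1r eqxx orbT.
- by rewrite subrr mul0r eqxx.
- have -> : 1 - 2%:R = -1 :> R by ring.
  by rewrite mulN1r eqxx !orbT.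
Qed.
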